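(* Let $\Bbbk$ be a field, $R=\Bbbk[x_1,\dots,x_m]$ with the standard $\mathbb Z^m$-grading, $L$ a Noetherian multigraded $R$-module with minimal multihomogeneous free presentation $E\xrightarrow{\Phi}G\to L\to0$, and $S$ a multihomogeneous basis of $E$. Let $\alpha$ be a generic element of $\Lambda(L)$. Then there is at most one $i\ge1$ with $\beta_{i,\alpha}(L)\ne0$; more precisely, for each $i\ge1$, \[ \beta_{i,\alpha}(L)=\begin{cases}\beta(\mathbf M_\alpha)&\text{if } i=|I_\alpha|-\operatorname{rank}\mathbf M_\alpha+1,\\0&\text{otherwise.}\end{cases} \]
   Context: $\beta_{i,\alpha}(L)=\dim_\Bbbk\operatorname{Tor}_i^R(L,\Bbbk)_\alpha$ (here $\Bbbk=R/(x_1,\dots,x_m)$) is the $i$-th multigraded Betti number of $L$ in multidegree $\alpha$. For nonempty $A\subseteq S$ let $\deg A\in\mathbb Z^m$ be the componentwise maximum of the multidegrees of the elements of $A$; the LCM-lattice is $\Lambda(L)=\{\deg A:\emptyset\ne A\subseteq S\}$. An element $\alpha\in\Lambda(L)$ is generic if $\{A\subseteq S:\deg A=\alpha\}$ is a closed interval $\{A:I_\alpha\subseteq A\subseteq I^\alpha\}$ of the Boolean lattice of subsets of $S$; set $I(\alpha)=I^\alpha\setminus I_\alpha$. Regard $\Bbbk$ as an $R$-module via $x_i\mapsto1$, let $W=G\otimes_R\Bbbk$, $U_S$ the $\Bbbk$-space with basis $\{e_a:a\in S\}$ identified with $E\otimes_R\Bbbk$ via $e_a=a\otimes1$, and $\phi=\Phi\otimes_R\Bbbk\colon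 U_S\to W$; for $B\subseteq S$ put $V_B=\phi(\operatorname{span}\{e_a:a\in B\})$. The matroid $\mathbf M_\alpha$ on $I_\alpha$ is the matroid represented by the composite $\operatorname{span}\{e_a:a\in I_\alpha\}\xrightarrow{\phi}W\to W/V_{I(\alpha)}$ (equivalently the contraction to $I_\alpha$ of the restriction to $I^\alpha$ of the matroid $\mathbf M(\phi)$ on $S$, whose independent sets are the $I$ with $\dim V_I=|I|$). Its rank function is $r_\alpha(J)=\dim V_{I(\alpha)\cup J}-\dim V_{I(\alpha)}$, $\operatorname{rank}\mathbf M_\alpha=r_\alpha(I_\alpha)$, and its $\beta$-invariant is $\beta(\mathbf M_\alpha)=(-1)^{r_\alpha(I_\alpha)}\sum_{J\subseteq I_\alpha}(-1)^{|J|}r_\alpha(J)$. *)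

(* Defs.v *)
(* Multigraded modules over R = K[x_1..x_m] given by their
   minimal multihomogeneous free presentation E --Phi--> G -> L -> 0;
   all computations are done multidegree by multidegree over the field K. *)
From HB Require Import structures.
From mathcomp Require Import all_boot all_order all_algebra.
Set Implicit Arguments. Unset Strict Implicit. Unset Printing Implicit Defensive.
Import Order.TTheory GRing.Theory Num.Theory.
Local Open Scope ring_scope.

Definition mdeg (m : nat) := 'I_m -> int.

Definition leqdeg (m : nat) (u v : mdeg m) : bool := [forall j, u j <= v j].

Definition shiftdeg (m : nat) (al : mdeg m) (F : {set 'I_m}) : mdeg m :=
  fun j => al j - (j \in F)%:Z.

Section Presentation.
Variables (K : fieldType) (m : nat) (Gb S : finType).
(* Gb : index set of a multihomogeneous basis g_b of G, deg g_b = dG b;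
   S  : multihomogeneous basis e_a of E, deg e_a = dE a;
   Phi(e_a) = sum_b (pcoef b a) x^(dE a - dG b) g_b, where the coefficient is
   forced to vanish unless dG b <= dE a (multihomogeneity of Phi). *)
Variables (dG : Gb -> mdeg m) (dE : S -> mdeg m) (c : Gb -> S -> K).

Definition pcoef (b : Gb) (a : S) : K :=
  if leqdeg (dG b) (dE a) then c b a else 0.

(* Minimality of the presentation:
   (1) Phi(E) is contained in m G (no unit entries);
   (2) the Phi(e_a) minimally generate Im Phi: no Phi(e_a) lies in the
       submodule generated by the other Phi(e_a'); in multidegree dE a this
       submodule is spanned (in the K-basis x^(dE a - dG b) g_b of G_(dE a))
       by the coefficient vectors of the Phi(e_a') with dE a' <= dE a. *)
Definition colvec (a : S) : {ffun Gb -> K^o} := [ffun b => pcoef b a].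

Definition minimal_presentation : Prop :=
  (forall a b, leqdeg (dG b) (dE a) -> leqdeg (dE a) (dG b) -> c b a = 0)
  /\ (forall a, colvec a \notin
        <<[seq colvec a' | a' <- enum S & (a' != a) && leqdeg (dE a') (dE a)]>>%VS).

(* ---------- Tor_i^R(L, k)_alpha via the Koszul resolution of k = R/(x) ------
   (L (x) K(x))_i in degree alpha = (+)_{|F| = i} L_(alpha - e_F),
   L_beta = G_beta / Phi(E)_beta.  We work in the lift
   C_i = (+)_{|F|=i} G_(alpha - e_F), with basis (F, b), dG b <= alpha - e_F,
   inside the ambient space KV of all functions on {set 'I_m} * Gb. *)
Definition KV := {ffun ({set 'I_m} * Gb) -> K^o}.

Definition kdelta (p : {set 'I_m} * Gb) : KV := [ffun q => (q == p)%:R].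

Variable al : mdeg m.

Definition Cspace (i : nat) : {vspace KV} :=
  <<[seq kdelta p | p <- enum [pred p : {set 'I_m} * Gb |
       (#|p.1| == i) && leqdeg (dG p.2) (shiftdeg al p.1)]]>>%VS.

(* Phi(e_a) * x^(alpha - e_F - dE a) (x) e_F, for dE a <= alpha - e_F *)
Definition phivec (pa : {set 'I_m} * S) : KV :=
  [ffun q => if q.1 == pa.1 then pcoef q.2 pa.2 else 0].

(* B_i = (+)_{|F|=i} Phi(E)_(alpha - e_F) *)
Definition Bspace (i : nat) : {vspace KV} :=
  <<[seq phivec pa | pa <- enum [pred pa : {set 'I_m} * S |
       (#|pa.1| == i) && leqdeg (dE pa.2) (shiftdeg al pa.1)]]>>%VS.

(* Koszul differential: u (x) e_F |-> sum_{j in F} (-1)^{#{k in F, k < j}} x_j u (x) e_{F\j};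
   on coordinates: (D u)(F', b) = sum_{j notin F'} sign * u(F' + j, b). *)
Definition kdiff_fun (u : KV) : KV :=
  [ffun p : {set 'I_m} * Gb =>
     \sum_(j < m | j \notin p.1)
        (-1) ^+ #|[set k in p.1 | (k < j)%N]| * u (j |: p.1, p.2)].

Definition kdiff : 'End(KV) := linfun kdiff_fun.

(* lifted cycles of the quotient complex: {u in C_i | D u in B_(i-1)} *)
Definition Zspace (i : nat) : {vspace KV} :=
  (Cspace i :&: kdiff @^-1: Bspace i.-1)%VS.

(* lifted boundaries of the quotient complex: D(C_(i+1)) + B_i *)
Definition Bdspace (i : nat) : {vspace KV} :=
  (kdiff @: Cspace i.+1 + Bspace i)%VS.

(* beta_{i,alpha}(L) = dim_K Tor_i^R(L,k)_alpha = dim H_i((L (x) K(x))_alpha) *)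
Definition betti (i : nat) : nat := (\dim (Zspace i) - \dim (Bdspace i))%N.

End Presentation.

Section Matroid.
Variables (K : fieldType) (m : nat) (Gb S : finType).
Variables (dG : Gb -> mdeg m) (dE : S -> mdeg m) (c : Gb -> S -> K).

Definition has_deg (A : {set S}) (al : mdeg m) : bool :=
  [&& A != set0, [forall a in A, leqdeg (dE a) al] &
      [forall j, [exists a in A, dE a j == al j]]].

Definition in_lcm_lattice (al : mdeg m) : Prop := exists A, has_deg A al.

(* phi = Phi (x)_R k with x_i |-> 1: e_a |-> sum_b pcoef b a g_b;
   V_B = phi(span{e_a : a in B}) *)
Definition Vsp (B : {set S}) : {vspace {ffun Gb -> K^o}} :=
  <<[seq colvec dG dE c a | a <- enum B]>>%VS.

Definition mrank (Ic J : {set S}) : nat := (\dim (Vsp (Ic :|: J)) - \dim (Vsp Ic))%N.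

Definition beta_inv (Il Ic : {set S}) : int :=
  (-1) ^+ (mrank Ic Il) * \sum_(J in powerset Il) (-1) ^+ #|J| * (mrank Ic J)%:Z.

End Matroid.

(* Main.v *)
(* The Koszul complex with values in G is exact in positive degrees, and by
   minimality the image of Phi contributes nothing to its degree zero homology,
   so beta_{i+1,alpha}(L) is the dimension of the i-th homology of the cubical
   complex F |-> V_{S_F}, S_F = {a | deg a <= alpha - e_F}.  Genericity
   produces for every x in I_alpha a variable j(x) with S_{j(x)} = I^alpha \ x,
   and every other variable j is dominated: S_j lies in some S_{j(x)}.
   Dominated variables can be deleted without changing exactness or the Euler
   characteristic.  What remains is the complex J |-> V_{I^alpha \ J} over the
   subsets J of I_alpha.  Deletion-contraction shows that its homology lives in
   the single degree |I_alpha| - rank, so the dimension there is, up to sign,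
   the Euler characteristic, which is the beta-invariant. *)
Require Import Defs.
From HB Require Import structures.
From mathcomp Require Import all_boot all_order all_algebra zify ring.
Set Implicit Arguments. Unset Strict Implicit. Unset Printing Implicit Defensive.
Import Order.TTheory GRing.Theory Num.Theory.
Local Open Scope ring_scope.

(** * Cubical complexes with coefficients in a family of subspaces *)

Section Cubical.
Variables (K : fieldType) (m : nat) (W : vectType K).
Implicit Types (D F : {set 'I_m}) (P : {set 'I_m} -> {vspace W}) (u v : {set 'I_m} -> W).

(* [ksign], [kd] are the signs and the differential of [kdiff_fun], for
   coefficients in an arbitrary space. *)
Definition ksign (j : 'I_m) F : K := (-1) ^+ #|[set k in F | (k < j)%N]|.

Definition kd u F : W := \sum_(j < m | j \notin F) ksign j F *: u (j |: F).

Lemma ksignK j F : ksign j F * ksign j F = 1.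
Proof. by rewrite -expr2 sqrr_sign. Qed.

Lemma ksignU i j F : i \notin F -> ksign j (i |: F) = ksign j F * (-1) ^+ (i < j)%N.
Proof.
move=> iF; rewrite /ksign -exprD; congr (_ ^+ _).
case: ltnP => ij; last first.
  rewrite addn0; apply: eq_card => k; rewrite !inE; case: eqP => //= ->.
  by rewrite ltnNge ij andbF.
rewrite addn1 -(_ : #|i |: [set k in F | (k < j)%N]| = #|[set k in F | (k < j)%N]|.+1).
  by apply: eq_card => k; rewrite !inE; case: eqP => //= ->; rewrite ij.
by rewrite cardsU1 !inE (negbTE iF).
Qed.

(** Exactly one of [i < j] and [j < i] holds, so exactly one side picks up an extra sign; this makes
    [kd] square to zero. *)
Lemma ksign_swap i j F : i != j -> i \notin F -> j \notin F ->
  ksign i F * ksign j (i |: F) = - (ksign j F * ksign i (j |: F)).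
Proof.
move=> ij iF jF; rewrite !ksignU // mulrCA !mulrA -mulrN.
congr (_ * _ * _); rewrite -val_eqE /= in ij.
by case: ltngtP ij => //= _ _; rewrite ?expr0 ?expr1 ?opprK.
Qed.

Lemma kd_eq u v : u =1 v -> kd u =1 kd v.
Proof. by move=> uv F; apply: eq_bigr => j _; rewrite uv. Qed.

Lemma kdD u v F : kd (fun F => u F + v F) F = kd u F + kd v F.
Proof. by rewrite -big_split; apply: eq_bigr => j _; rewrite scalerDr. Qed.

Lemma kdB u v F : kd (fun F => u F - v F) F = kd u F - kd v F.
Proof. by rewrite -sumrB; apply: eq_bigr => j _; rewrite scalerBr. Qed.

Lemma kd0 F : kd (fun _ => 0) F = 0.
Proof. by apply: big1 => j _; rewrite scaler0. Qed.

Lemma kd_lin (f : {linear W -> W}) u F : kd (fun F => f (u F)) F = f (kd u F).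
Proof. by rewrite linear_sum; apply: eq_bigr => j _; rewrite linearZ. Qed.

Lemma kd_kd u F : kd (kd u) F = 0.
Proof.
pose G (i j : 'I_m) := (ksign i F * ksign j (i |: F)) *: u (j |: (i |: F)).
transitivity (\sum_(i < m | i \notin F) \sum_(j < m | (j != i) && (j \notin F)) G i j).
  apply: eq_bigr => i iF; rewrite scaler_sumr; apply: eq_big => [j|j _].
    by rewrite in_setU1 negb_or.
  by rewrite scalerA.
have E i : \sum_(j < m | (j != i) && (j \notin F)) G i j =
    \sum_(j < m | j \notin F) (if (i < j)%N then G i j else 0) +
    \sum_(j < m | j \notin F) (if (j < i)%N then G i j else 0).
  rewrite -big_split /= [LHS]big_mkcond [RHS]big_mkcond; apply: eq_bigr => j _.
  rewrite -val_eqE /=; case: (j \in F); rewrite /= ?andbF // andbT.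
  by case: ltngtP => //=; rewrite ?addr0 ?add0r.
rewrite (eq_bigr _ (fun i _ => E i)) big_split /= [X in _ + X]exchange_big /=.
rewrite -big_split big1 //= => i iF; rewrite -big_split big1 //= => j jF.
case: ltnP => ij; rewrite ?addr0 // /G setUCA.
rewrite (ksign_swap (i := i) (j := j)) //; last by rewrite -val_eqE /= ltn_eqF.
by rewrite scaleNr addNr.
Qed.

(* Splitting chains by whether x lies in the index set makes the complex a
   mapping cone: [cone x] embeds the part indexed by sets containing x, and
   [link x] projects onto it. *)
Definition cone x u F : W := if x \in F then ksign x (F :\ x) *: u (F :\ x) else 0.

Definition link x u F : W := if x \in F then 0 else ksign x F *: u (x |: F).

(** [cone x] is a contracting homotopy on unrestricted functions; exactness then only asks whether
    it respects the family [P]. *)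
Lemma kd_cone x u F : kd (cone x u) F = u F - cone x (kd u) F.
Proof.
rewrite {2}/cone; case: ifPn => xF; last first.
  rewrite subr0 /kd (bigD1 x) //= big1 => [|j /andP[jF jx]].
    by rewrite addr0 /cone setU11 scalerA setU1K // ksignK scale1r.
  by rewrite /cone in_setU1 eq_sym (negbTE jx) (negbTE xF) scaler0.
rewrite {2}/kd (bigD1 x) ?setD11 //= scalerDr scalerA ksignK scale1r setD1K //.
rewrite opprD addNKr -scalerN -sumrN scaler_sumr; apply: eq_big => [j|j jF].
  rewrite !inE negb_and negbK; case: eqP => [->|_] /=; last by rewrite andbT.
  by rewrite xF.
rewrite /cone in_setU1 xF orbT.
have jx : j != x by apply: contraNneq jF => ->.
have -> : (j |: F) :\ x = j |: (F :\ x).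
  by apply/setP=> k; rewrite !inE; case: (k =P j) => // ->; rewrite (negbTE jF) jx.
rewrite scalerN scalerA -scaleNr scalerA; congr (_ *: _).
have jF' : j \notin F :\ x by rewrite !inE (negbTE jF) andbF.
have := ksign_swap jx jF' (negbT (setD11 _ _)).
rewrite setD1K // => E.
rewrite -[LHS]mulr1 -(ksignK j (F :\ x)) [ksign j F * _]mulrC mulrACA.
rewrite [ksign x _ * ksign j _]mulrC E !mulNr; congr (- _).
by rewrite -mulrA (mulrA (ksign j F)) ksignK mul1r.
Qed.

Lemma kd_link x u F : kd (link x u) F = - link x (kd u) F.
Proof.
rewrite {2}/link; case: ifPn => xF.
  by rewrite oppr0; apply: big1 => j _; rewrite /link in_setU1 xF orbT scaler0.
rewrite /kd (bigD1 x) //= {1}/link setU11 scaler0 add0r.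
rewrite scaler_sumr -sumrN; apply: eq_big => [j|j /andP[jF jx]].
  by rewrite in_setU1 negb_or andbC.
rewrite /link in_setU1 eq_sym (negbTE jx) (negbTE xF) !scalerA -scaleNr setUCA.
by rewrite (ksign_swap jx).
Qed.

Lemma cone_link x u F : cone x (link x u) F = if x \in F then u F else 0.
Proof.
rewrite /cone; case: ifP => // xF.
by rewrite /link setD11 scalerA ksignK scale1r setD1K.
Qed.

(** Chains are total functions forced to vanish off the [k]-subsets of [D], so that one differential
    [kd] serves every [D] and [k]. *)
Definition chain D P k u : Prop :=
  forall F, if (F \subset D) && (#|F| == k) then u F \in P F else u F == 0.

Lemma chain_sub D P k u F : chain D P k u -> F \subset D -> u F \in P F.
Proof. by move=> /(_ F); case: ifP => // _ /eqP-> _; rewrite mem0v. Qed.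

Lemma chain_out D P k u F : chain D P k u -> ~~ ((F \subset D) && (#|F| == k)) -> u F = 0.
Proof. by move=> /(_ F); case: ifP => // _ /eqP. Qed.

Lemma chainI D P k u : (forall F, F \subset D -> #|F| = k -> u F \in P F) ->
  (forall F, ~~ ((F \subset D) && (#|F| == k)) -> u F = 0) -> chain D P k u.
Proof.
move=> uP u0 F; case: ifPn => [/andP[FD /eqP Fk]|/u0->//].
exact: uP.
Qed.

Lemma chain_mono D D' P P' k u : D \subset D' ->
  (forall F, F \subset D -> (P F <= P' F)%VS) -> chain D P k u -> chain D' P' k u.
Proof.
move=> sD sP uP; apply: chainI => F; last first.
  move=> nF; apply: (chain_out uP); apply: contraNN nF => /andP[FD ->].
  by rewrite (subset_trans FD).
move=> _ _; case: (boolP (F \subset D)) => FD.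
  by apply: (subvP (sP _ FD)); apply: chain_sub uP _.
by rewrite (chain_out uP) ?mem0v // (negbTE FD).
Qed.

Lemma chain_kd D P k u : (forall j F, F \subset D -> (P (j |: F) <= P F)%VS) ->
  chain D P k.+1 u -> chain D P k (kd u).
Proof.
move=> sP uP; apply: chainI => F.
  move=> FD _; apply: memv_suml => j jF; apply: rpredZ.
  have [jD|jD] := boolP (j \in D).
    by apply: (subvP (sP j F FD)); apply: (chain_sub uP); rewrite subUset sub1set jD.
  by rewrite (chain_out uP) ?mem0v // subUset sub1set (negbTE jD).
move=> nF; apply: big1 => j jF; rewrite (chain_out uP) ?scaler0 //.
apply: contraNN nF; rewrite cardsU1 jF eqSS => /andP[jFD ->].
by rewrite andbT (subset_trans _ jFD) // subsetUr.
Qed.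

(** In degree 0 the cycle condition is automatic: the complex is not augmented. *)
Definition exact D P k : Prop := forall u, chain D P k u -> kd u =1 (fun=> 0) ->
  exists2 v, chain D P k.+1 v & kd v =1 u.

Lemma eq_exact D P P' k : (forall F, F \subset D -> P F = P' F) ->
  exact D P k -> exact D P' k.
Proof.
move=> eP ex u uP u0; case: (ex u _ u0) => [|v vP vu].
  by apply: chain_mono uP => // F /eP->.
by exists v => //; apply: chain_mono vP => // F /eP->.
Qed.

Lemma chain_cone x D P k u : x \in D ->
  chain (D :\ x) (fun F => P (x |: F)) k u -> chain D P k.+1 (cone x u).
Proof.
move=> xD uP; apply: chainI => F; rewrite /cone.
  move=> FD _; case: ifP => xF; last exact: mem0v.
  rewrite -{3}(setD1K xF); apply: rpredZ.
  by apply: (chain_sub uP); apply: setSD.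
move=> nF; case: ifP => // xF; rewrite (chain_out uP) ?scaler0 //.
apply: contraNN nF => /andP[FD Fk]; rewrite -(setD1K xF) cardsU1 setD11 eqSS Fk andbT.
by rewrite subUset sub1set xD (subset_trans FD) // subD1set.
Qed.

Lemma exact_cone x D P k : x \in D ->
  (forall F, F \subset D :\ x -> P (x |: F) = P F) -> exact D P k.
Proof.
move=> xD Px u uP u0; exists (cone x u); last first.
  by move=> F; rewrite kd_cone /cone u0 scaler0 if_same subr0.
apply: chainI => F; rewrite /cone.
  move=> FD _; case: ifP => xF; last exact: mem0v.
  rewrite -{3}(setD1K xF) Px ?setSD //; apply: rpredZ.
  by apply: (chain_sub uP); rewrite (subset_trans _ FD) // subD1set.
move=> nF; case: ifP => // xF; rewrite (chain_out uP) ?scaler0 //.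
apply: contraNN nF => /andP[FD Fk]; rewrite -(setD1K xF) cardsU1 setD11 eqSS Fk andbT.
by rewrite subUset sub1set xD FD.
Qed.

(** The long exact sequence of the mapping cone: sets containing [x] carry the family [P (x |: F)],
    shifted by one degree, on top of the sets avoiding [x]. *)
Lemma exact_link x D P k : x \in D ->
  (forall F, F \subset D :\ x -> (P (x |: F) <= P F)%VS) ->
  exact (D :\ x) P k ->
  (forall k', k = k'.+1 -> exact (D :\ x) (fun F => P (x |: F)) k') ->
  exact D P k.
Proof.
move=> xD Px ex ex' u uP u0.
(* First bound the part of [u] on sets containing [x]; for [k = 0] that part is zero. *)
have [v1 v1P v1u] : exists2 v1, chain (D :\ x) (fun F => P (x |: F)) k v1
                              & kd v1 =1 link x u.
  case: k ex' {ex} uP => [_|k ex'] uP.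
    exists (fun=> 0).
      by apply: chainI => // F _ _; apply: mem0v.
    move=> F; rewrite kd0 /link; case: ifP => // xF; rewrite (chain_out uP) ?scaler0 //.
    by rewrite cardsU1 xF andbF.
  apply: (ex' k erefl) => [|F]; last by rewrite kd_link /link u0 scaler0 if_same oppr0.
  apply: chainI => F; rewrite /link.
    move=> FD _; case: ifP => // xF; first exact: mem0v.
    apply: rpredZ; apply: (chain_sub uP).
    by rewrite subUset sub1set xD (subset_trans FD) // subD1set.
  move=> nF; case: ifPn => // xF; rewrite (chain_out uP) ?scaler0 //.
  apply: contraNN nF; rewrite cardsU1 xF eqSS => /andP[FD ->].
  by rewrite subsetD1 xF andbT andbT (subset_trans _ FD) // subsetUr.
(* Adding the boundary of [cone x v1] cancels the values of [u] on sets containing [x], leaving a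
   cycle over [D :\ x]. *)
pose u' F := (if x \in F then 0 else u F) + v1 F.
have u'E F : u' F = u F + kd (cone x v1) F.
  have -> : kd (cone x v1) F = v1 F - if x \in F then u F else 0.
    by rewrite kd_cone -(cone_link x u) /cone v1u.
  by rewrite /u'; case: ifP; rewrite ?subr0 // add0r addrCA subrr addr0.
have [w wP wu] : exists2 w, chain (D :\ x) P k.+1 w & kd w =1 u'.
  apply: ex => [|F]; last first.
    by rewrite (kd_eq u'E) kdD kd_kd u0 addr0.
  apply: chainI => F; rewrite /u'.
    move=> FD Fk; apply: rpredD.
      case: ifP => _; first exact: mem0v.
      by apply: (chain_sub uP); rewrite (subset_trans FD) // subD1set.
    by apply: (subvP (Px F FD)); apply: (chain_sub v1P).
  move=> nF; rewrite (chain_out v1P) // addr0.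
  case: ifPn => // xF; apply: (chain_out uP); apply: contraNN nF.
  by rewrite subsetD1 xF andbT.
exists (fun F => w F - cone x v1 F); last first.
  by move=> F; rewrite kdB wu u'E addrK.
have wP' : chain D P k.+1 w by apply: chain_mono wP => //; apply: subD1set.
have cP := chain_cone xD v1P.
apply: chainI => F.
  by move=> FD _; apply: rpredB; [apply: chain_sub wP' FD|apply: chain_sub cP FD].
by move=> nF; rewrite (chain_out wP') // (chain_out cP) // subr0.
Qed.

(** Applied pointwise, [f] commutes with [kd], so a cycle splits into one in [P1] and one in [P2],
    bounded separately. *)
Lemma exact_split (f : 'End(W)) D P P1 P2 k :
  (forall F, F \subset D -> (P1 F <= P F)%VS) ->
  (forall F, F \subset D -> (P2 F <= P F)%VS) ->
  (forall F w, F \subset D -> w \in P F -> f w \in P1 F /\ w - f w \in P2 F) ->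
  exact D P1 k -> exact D P2 k -> exact D P k.
Proof.
move=> s1 s2 fP ex1 ex2 u uP u0.
have [|F|v1 v1P v1u] := ex1 (fun F => f (u F)).
- apply: chainI => F; first by move=> FD _; case: (fP F (u F) FD (chain_sub uP FD)).
  by move=> nF; rewrite (chain_out uP nF) linear0.
- by rewrite kd_lin u0 linear0.
have [|F|v2 v2P v2u] := ex2 (fun F => u F - f (u F)).
- apply: chainI => F; first by move=> FD _; case: (fP F (u F) FD (chain_sub uP FD)).
  by move=> nF; rewrite (chain_out uP nF) linear0 subr0.
- by rewrite kdB kd_lin u0 linear0 subr0.
exists (fun F => v1 F + v2 F); last by move=> F; rewrite kdD v1u v2u addrC subrK.
have v1P' := chain_mono (subxx D) s1 v1P.
have v2P' := chain_mono (subxx D) s2 v2P.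
apply: chainI => F.
  by move=> FD _; apply: rpredD; [apply: chain_sub v1P' FD|apply: chain_sub v2P' FD].
by move=> nF; rewrite (chain_out v1P') // (chain_out v2P') // addr0.
Qed.

End Cubical.

(** * Exactness for a vector configuration *)

Lemma capv_line0 (K : fieldType) (W : vectType K) (U : {vspace W}) w :
  w \notin U -> (U :&: <[w]> = 0)%VS.
Proof.
move=> wU; apply/eqP; rewrite -subv0; apply/subvP=> v /memv_capP[vU /vlineP[a va]].
rewrite memv0; apply: contraNT wU => v0.
have a0 : a != 0 by apply: contraNneq v0 => a0; rewrite va a0 scale0r.
by rewrite -[w](scalerK a0) -va rpredZ.
Qed.

Section Configuration.
Variables (K : fieldType) (m : nat) (W : vectType K) (w : 'I_m -> W).
Implicit Types (B : {vspace W}) (D F : {set 'I_m}).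

(* For D = I_alpha and B = V_{I(alpha)}, [cospan D B F] is V_{I^alpha \ F}. *)
Definition cospan D B F : {vspace W} := (B + \sum_(t in (D :\: F)%SET) <[w t]>)%VS.

Lemma cospan_contract x D B F : x \in D -> x \notin F ->
  cospan D B F = cospan (D :\ x) (B + <[w x]>) F.
Proof.
move=> xD xF; rewrite /cospan (big_setD1 x) /= ?inE ?xF // addvA.
by rewrite !setDDl setUC.
Qed.

Lemma cospan_delete x D B F : cospan D B (x |: F) = cospan (D :\ x) B F.
Proof. by rewrite /cospan setDDl. Qed.

Lemma cospan_base D B F : (B <= cospan D B F)%VS.
Proof. exact: addvSl. Qed.

Lemma cospan_anti D B F F' : F \subset F' -> (cospan D B F' <= cospan D B F)%VS.
Proof.
move=> FF'; apply: addvS => //; apply/subv_sumP => t tF'.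
by rewrite (sumv_sup t) // (subsetP (setDS D FF')).
Qed.

(* Here #|D| + \dim B - \dim (cospan D B set0) is the corank of the
   configuration w on D modulo B. *)
Lemma exact_cospan D B k :
  (k + \dim (cospan D B set0) != #|D| + \dim B)%N -> exact D (cospan D B) k.
Proof.
have [n] := ubnP #|D|; elim: n => // n IHn in D B k *; rewrite ltnS => Dn kr.
have [D0|[x xD]] := set_0Vmem D.
  move=> u uP u0; exists (fun=> 0).
    by apply: chainI => // F _ _; apply: mem0v.
  move=> F; rewrite kd0 (chain_out uP) // D0 subset0; apply/negP=> /andP[/eqP-> /eqP k0].
  by move: kr; rewrite D0 /cospan set0D big_set0 addv0 -k0 eqxx.
have cD : #|D| = #|D :\ x|.+1 by rewrite (cardsD1 x) xD.
have x0 : x \notin set0 by rewrite inE.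
(* x is a loop: deleting it changes nothing, so x is an apex. *)
have [wB|wB] := boolP (w x \in B).
  apply: (exact_cone xD) => F; rewrite subsetD1 => /andP[_ xF].
  rewrite cospan_delete (cospan_contract _ xD xF); congr (cospan _ _ _).
  by symmetry; apply/addv_idPl; rewrite -memvE.
have dB : \dim (B + <[w x]>) = (\dim B).+1.
  rewrite dimv_disjoint_sum ?capv_line0 //.
  rewrite dim_vline addnC; case: eqP wB => //= ->; by rewrite mem0v.
(* x is neither a loop nor a coloop: [link x] relates contraction and deletion. *)
have [wX|wX] := boolP (w x \in cospan (D :\ x) B set0).
  apply: (exact_link xD).
  - by move=> F _; apply: cospan_anti; apply: subsetUr.
  - apply: (@eq_exact _ _ _ _ (cospan (D :\ x) (B + <[w x]>))).
      by move=> F; rewrite subsetD1 => /andP[_ xF]; rewrite (cospan_contract _ xD).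
    apply: IHn; first by rewrite -ltnS -cD.
    (* Contraction loses one element and raises [\dim B] by one, so the excluded degree is
       unchanged. *)
    by rewrite -cospan_contract // dB addnS -addSn -cD.
  - move=> k' kk'; apply: (@eq_exact _ _ _ _ (cospan (D :\ x) B)).
      by move=> F _; rewrite cospan_delete.
    apply: IHn; first by rewrite -ltnS -cD.
    (* Deletion keeps the span and loses one element, so the excluded degree drops by one, as [k]
       does to [k']. *)
    have <- : cospan D B set0 = cospan (D :\ x) B set0.
      rewrite (cospan_contract _ xD x0) /cospan -addvA (addvC <[w x]>%VS) addvA -/(cospan _ _ _).
      by apply/addv_idPl; rewrite -memvE.
    by move: kr; rewrite kk' cD !addSn eqSS.
(* x is a coloop: unless D = [set x], the complex splits into the deletion of x,
   with apex x, and a constant line over D :\ x. *)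
have [D'0|[y yD]] := set_0Vmem (D :\ x).
  have D1 : D = [set x] by rewrite -(setD1K xD) D'0 setU0.
  (* The excluded degree of a single coloop is 0. *)
  have k0 : (k != 0)%N.
    apply: contraNneq kr => ->.
    by rewrite (cospan_contract _ xD x0) D'0 /cospan set0D big_set0 addv0 dB cD D'0 cards0.
  move=> u uP u0; exists (fun=> 0).
    by apply: chainI => // F _ _; apply: mem0v.
  move=> F; rewrite kd0; have [Fx|Fx] := eqVneq F [set x]; last first.
    rewrite (chain_out uP) // D1 subset1 (negbTE Fx) /=.
    by apply/negP=> /andP[/eqP->]; rewrite cards0 eq_sym (negbTE k0).
  (* The only possible value sits at [[set x]], and the differential at [set0] reads it off up to
     sign. *)
  have := u0 set0; rewrite /kd (bigD1 x) //= big1 => [|j /andP[_ jx]]; last first.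
    rewrite (chain_out uP) ?scaler0 // D1 subUset !sub1set inE (negbTE jx) //.
  rewrite addr0 setU0 -Fx => /eqP; rewrite scaler_eq0 signr_eq0 /=.
  by move=> /eqP->.
pose X := cospan (D :\ x) B set0.
have XL : (X :&: <[w x]> = 0)%VS by apply: capv_line0.
(* All deletion spaces lie in [X], so the projection onto [X] along [w x] fixes them and kills the
   line. *)
pose f := daddv_pi X <[w x]>.
pose L F := if x \in F then 0%VS else <[w x]>%VS.
apply: (@exact_split _ _ _ f _ _ (fun F => cospan (D :\ x) B F) L).
- by move=> F _; rewrite -cospan_delete; apply: cospan_anti; apply: subsetUr.
- move=> F FD; rewrite /L; case: ifPn => xF; first exact: sub0v.
  by rewrite (cospan_contract _ xD xF) (subv_trans (addvSr B _)) // cospan_base.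
- move=> F v FD vP.
  have fX z : z \in cospan (D :\ x) B F -> f z = z.
    move=> zP; apply: (daddv_pi_id XL); apply: (subvP _ z zP).
    exact/cospan_anti/sub0set.
  rewrite /L; case: ifPn => xF.
    have vP' : v \in cospan (D :\ x) B F.
      by rewrite -cospan_delete (setUidPr _) // sub1set.
    by rewrite fX // subrr mem0v.
  move: vP; rewrite (cospan_contract _ xD xF) {1}/cospan.
  rewrite -addvA (addvC <[w x]>%VS) addvA -/(cospan _ _ _).
  case/memv_addP=> z zP [l lL ->]; rewrite linearD /= fX //.
  have -> : f l = 0.
    have /(daddv_pi_add XL) : l \in (X + <[w x]>)%VS by apply: subvP lL; apply: addvSr.
    rewrite [X in _ + X]daddv_pi_id ?[(<[_]> :&: _)%VS]capvC //.
    by move/(canRL (addrK l)); rewrite subrr.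
  by rewrite addr0 zP addrC addKr.
- apply: (exact_cone xD) => F FD; by rewrite -!(cospan_delete x) setUA setUid.
- have yx : y != x by move: yD; rewrite !inE => /andP[].
  apply: (@exact_cone _ _ _ y D); first by move: yD; rewrite inE => /andP[].
  by move=> F _; rewrite /L in_setU1 eq_sym (negbTE yx).
Qed.
End Configuration.

(** * The Koszul spaces, decomposed along the exterior basis *)

Lemma span_ffun0 (K : fieldType) (T : finType) (X : seq {ffun T -> K^o}) v t :
  (forall x, x \in X -> x t = 0) -> v \in <<X>>%VS -> v t = 0.
Proof.
move=> X0 vX; rewrite (@coord_span _ _ _ (in_tuple X) _ vX) sum_ffunE.
by apply: big1 => i _; rewrite ffunE X0 ?scaler0 // mem_nth.
Qed.

Section KoszulSpaces.
Variables (K : fieldType) (m : nat) (Gb S : finType).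
Variables (dG : Gb -> mdeg m) (dE : S -> mdeg m) (c : Gb -> S -> K) (al : mdeg m).
Implicit Types (F : {set 'I_m}) (U : KV K m Gb).

Local Notation KV := (KV K m Gb).
Local Notation V := {ffun Gb -> K^o}.
Local Notation kdiff := (kdiff K m Gb).

Definition slice F U : V := [ffun b => U (F, b)].

Definition stalk F (v : V) : KV := [ffun q => if q.1 == F then v q.2 else 0].

Lemma kdiff_fun_is_linear : linear (@kdiff_fun K m Gb).
Proof.
move=> a u v; apply/ffunP=> q; rewrite !ffunE scaler_sumr -big_split /=.
by apply: eq_bigr => j _; rewrite !ffunE mulrDr scalerAr.
Qed.
HB.instance Definition _ :=
  GRing.isLinear.Build K KV KV *:%R (@kdiff_fun K m Gb) kdiff_fun_is_linear.

Lemma stalk_is_linear F : linear (stalk F).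
Proof.
move=> a u v; apply/ffunP=> q; rewrite !ffunE.
by case: ifP; rewrite ?ffunE ?scaler0 ?addr0.
Qed.
HB.instance Definition _ F := GRing.isLinear.Build K V KV *:%R (stalk F) (stalk_is_linear F).

Lemma slice_is_linear F : linear (slice F).
Proof. by move=> a u v; apply/ffunP=> q; rewrite !ffunE. Qed.
HB.instance Definition _ F :=
  GRing.isLinear.Build K KV V *:%R (slice F) (slice_is_linear F).

Lemma stalkK F v : slice F (stalk F v) = v.
Proof. by apply/ffunP=> b; rewrite !ffunE eqxx. Qed.

Lemma slice_stalk F F' v : F' != F -> slice F' (stalk F v) = 0.
Proof. by move=> nF; apply/ffunP=> b; rewrite !ffunE /= (negbTE nF). Qed.

Lemma sum_stalk U : U = \sum_F stalk F (slice F U).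
Proof.
apply/ffunP=> -[F b]; rewrite sum_ffunE (bigD1 F) //= big1 => [|F' nF].
  by rewrite !ffunE eqxx addr0.
by rewrite !ffunE /= eq_sym (negbTE nF).
Qed.

Lemma slice_inj U U' : slice^~ U =1 slice^~ U' -> U = U'.
Proof. by move=> e; rewrite (sum_stalk U) (sum_stalk U'); apply: eq_bigr => F _; rewrite e. Qed.

Definition unslice (u : {set 'I_m} -> V) : KV := [ffun q => u q.1 q.2].

Lemma unsliceK u : slice^~ (unslice u) =1 u.
Proof. by move=> F; apply/ffunP=> b; rewrite !ffunE. Qed.

Lemma slice_kdiff U F : slice F (kdiff U) = kd (slice^~ U) F.
Proof.
apply/ffunP=> b; rewrite ffunE /Defs.kdiff lfunE /= !ffunE sum_ffunE.
by apply: eq_bigr => j _; rewrite !ffunE.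
Qed.

Lemma kdiffK U : kdiff (kdiff U) = 0.
Proof.
apply: slice_inj => F; rewrite slice_kdiff linear0.
by rewrite (kd_eq (slice_kdiff U)) kd_kd.
Qed.

(** This is S_F: the generators with a monomial multiple in degree [al - e_F]. *)
Definition below F : {set S} := [set a | leqdeg (dE a) (shiftdeg al F)].

Local Notation PB := (fun F => Vsp dG dE c (below F)).
Local Notation Bspace := (Bspace dG dE c al).
Local Notation Cspace := (Cspace K dG al).

Lemma phivec_stalk F a : phivec dG dE c (F, a) = stalk F (colvec dG dE c a).
Proof. by apply/ffunP=> q; rewrite !ffunE /=; case: ifP; rewrite ?ffunE. Qed.

Lemma BspaceE k : Bspace k = (\sum_(F : {set 'I_m} | #|F| == k) linfun (stalk F) @: PB F)%VS.
Proof.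
apply/eqP; rewrite eqEsubv; apply/andP; split.
  apply/span_subvP=> v /mapP[[F a]]; rewrite mem_enum inE /= => /andP[Fk Fa] ->.
  apply: (subvP (sumv_sup F Fk (subvv _))); rewrite phivec_stalk.
  have -> : stalk F (colvec dG dE c a) = linfun (stalk F) (colvec dG dE c a) by rewrite lfunE.
  by apply/memv_img/memv_span/map_f; rewrite mem_enum inE.
apply/subv_sumP=> F Fk; rewrite limg_span; apply/span_subvP=> v /mapP[_ /mapP[a aF ->] ->].
rewrite lfunE /= -phivec_stalk; apply/memv_span/map_f.
by rewrite mem_enum inE /= Fk; move: aF; rewrite mem_enum inE.
Qed.

(** Setting the variables to 1 identifies Phi(E) in degree [al - e_F] with [PB F], so [Bspace k] is
    the degree [k] part of the cubical complex over all variables. *)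
Lemma memBP k U : (U \in Bspace k) <-> chain setT PB k (slice^~ U).
Proof.
rewrite BspaceE; split=> [/memv_sumP[us usP ->]|UP].
  have us0 F F' : #|F'| == k -> F != F' -> slice F (us F') = 0.
    by move=> F'k FF'; case/memv_imgP: (usP F' F'k) => w _ ->; rewrite lfunE /= slice_stalk.
  apply: chainI => F.
    move=> _ /eqP Fk; rewrite linear_sum (bigD1 F) //= big1 => [|F' /andP[F'k F'F]].
      by case/memv_imgP: (usP F Fk) => w wP ->; rewrite lfunE /= stalkK addr0.
    by apply: us0; rewrite // eq_sym.
  rewrite subsetT /= => Fk; rewrite linear_sum big1 //= => F' F'k.
  by apply: us0 => //; apply: contraNneq Fk => ->.
rewrite [U]sum_stalk (bigID (fun F : {set 'I_m} => #|F| == k)) /=.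
rewrite [X in _ + X]big1 ?addr0 => [|F Fk]; last first.
  by rewrite (chain_out (F := F) UP) ?linear0 // (negbTE Fk) andbF.
apply: memv_sumr => F Fk.
have -> : stalk F (slice F U) = linfun (stalk F) (slice F U) by rewrite lfunE.
by apply/memv_img/(chain_sub (F := F) UP)/subsetT.
Qed.

(** Stalks over distinct sets have disjoint supports and each [stalk F] is injective, so the sum is
    direct. *)
Lemma dim_Bspace k : \dim (Bspace k) = (\sum_(F : {set 'I_m} | #|F| == k) \dim (PB F))%N.
Proof.
rewrite BspaceE.
have -> : (\dim (\sum_(F : {set 'I_m} | #|F| == k) linfun (stalk F) @: PB F) =
   \sum_(F : {set 'I_m} | #|F| == k) \dim (linfun (stalk F) @: PB F))%N.
  apply/directvP/directv_sum_independent => us usP us0 F Fk.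
  have := congr1 (slice F) us0; rewrite linear0 linear_sum (bigD1 F) //= big1 => [|i /andP[ik iF]].
    case/memv_imgP: (usP F Fk) => w _ ->; rewrite lfunE /= stalkK addr0 => ->.
    by rewrite linear0.
  by case/memv_imgP: (usP i ik) => w _ ->; rewrite lfunE /= slice_stalk // eq_sym.
apply: eq_bigr => F _; apply: limg_dim_eq.
apply/eqP; rewrite -subv0; apply/subvP=> v /memv_capP[_].
rewrite memv_ker lfunE memv0 /= => /eqP v0.
by rewrite -(stalkK F v) v0 linear0.
Qed.

Lemma memCP k U : reflect (forall F b, U (F, b) != 0 -> #|F| == k /\ leqdeg (dG b) (shiftdeg al F))
  (U \in Cspace k).
Proof.
apply: (iffP idP) => [UC F b|UP].
  move=> nz; apply/andP; apply: contraNT nz => nFb.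
  apply/eqP/(span_ffun0 _ UC) => _ /mapP[p + ->]; rewrite mem_enum inE => pP.
  by rewrite ffunE; case: eqP => // E; rewrite -E /= in pP; rewrite pP in nFb.
have -> : U = \sum_p U p *: kdelta K p.
  apply/ffunP=> q; rewrite sum_ffunE (bigD1 q) //= big1 => [|p pq].
    by rewrite !ffunE eqxx addr0 /GRing.scale /= mulr1.
  by rewrite !ffunE eq_sym (negbTE pq) scaler0.
apply: memv_suml => -[F b] _; have [->|/UP[Fk Fb]] := eqVneq (U (F, b)) 0.
  by rewrite scale0r mem0v.
apply/rpredZ/memv_span/map_f; by rewrite mem_enum inE /= Fk.
Qed.
End KoszulSpaces.

(** * Multidegrees shifted by a set of variables *)

Section Degrees.
Variable m : nat.
Implicit Types (u v al : mdeg m) (F : {set 'I_m}).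

Lemma leqdeg_trans v u w : leqdeg u v -> leqdeg v w -> leqdeg u w.
Proof. by move=> /forallP uv /forallP vw; apply/forallP=> j; apply: le_trans (uv j) (vw j). Qed.

(** Degrees are integers, so [u j <= al j - 1] means [u j < al j]: a generator of degree [u] below
    [al] survives on all subsets of one fixed set of variables. *)
Lemma leqdeg_shift u al F :
  leqdeg u (shiftdeg al F) = leqdeg u al && (F \subset [set j | u j < al j]).
Proof.
apply/forallP/andP=> [uF|[/forallP ual /subsetP Fu] j].
  split; first by apply/forallP=> j; move: (uF j); rewrite /shiftdeg; lia.
  by apply/subsetP=> j jF; move: (uF j); rewrite inE /shiftdeg jF; lia.
rewrite /shiftdeg; have := ual j; case: (boolP (j \in F)) => [/Fu|_]; rewrite ?inE; lia.
Qed.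

Lemma shiftdeg_anti al F F' : F \subset F' -> leqdeg (shiftdeg al F') (shiftdeg al F).
Proof.
move=> /subsetP FF'; apply/forallP=> j; rewrite /shiftdeg.
by have := FF' j; case: (j \in F) => [/(_ isT)->|_] //; lia.
Qed.
End Degrees.

(** * Betti numbers as homology of the image of Phi *)

Section KoszulHomology.
Variables (K : fieldType) (m : nat) (Gb S : finType).
Variables (dG : Gb -> mdeg m) (dE : S -> mdeg m) (c : Gb -> S -> K) (al : mdeg m).
Implicit Types (F : {set 'I_m}) (U : KV K m Gb).

Local Notation KV := (KV K m Gb).
Local Notation V := {ffun Gb -> K^o}.
Local Notation kdiff := (kdiff K m Gb).
Local Notation PB := (fun F => Vsp dG dE c (below dE al F)).
Local Notation Bspace := (Bspace dG dE c al).
Local Notation Cspace := (Cspace K dG al).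

Lemma Vsp_mono (A B : {set S}) : A \subset B -> (Vsp dG dE c A <= Vsp dG dE c B)%VS.
Proof.
move=> /subsetP AB; apply: sub_span => _ /mapP[a aA ->]; apply: map_f.
by move: aA; rewrite !mem_enum; apply: AB.
Qed.

Lemma PB_anti F F' : F \subset F' -> (PB F' <= PB F)%VS.
Proof.
move=> FF'; apply: Vsp_mono; apply/subsetP=> a; rewrite !inE => aF.
exact: leqdeg_trans aF (shiftdeg_anti _ FF').
Qed.

Lemma kdiffE U F b : kdiff U (F, b) = kd (fun F => U (F, b) : K^o) F.
Proof.
have := congr1 (fun f : V => f b) (slice_kdiff U F); rewrite ffunE => ->.
by rewrite sum_ffunE; apply: eq_bigr => j _; rewrite !ffunE.
Qed.

Lemma Bspace_sub k : (Bspace k <= Cspace k)%VS.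
Proof.
apply/span_subvP=> v /mapP[[F a]]; rewrite mem_enum inE /= => /andP[Fk Fa] ->.
apply/memCP=> F' b; rewrite ffunE /=; have [->|_] := eqVneq F' F; last by rewrite eqxx.
by rewrite /pcoef; case: ifP => [ba _|]; [split=> //; apply: leqdeg_trans ba Fa|rewrite eqxx].
Qed.

Lemma kdiff_Cspace k : (kdiff @: Cspace k.+1 <= Cspace k)%VS.
Proof.
apply/subvP=> _ /memv_imgP[U /memCP UC ->]; apply/memCP=> F b nz.
have [j jF Uj] : exists2 j, j \notin F & U (j |: F, b) != 0.
  apply/exists_inP; apply: contraNT nz => /exists_inPn U0.
  rewrite kdiffE; apply/eqP; apply: big1 => j jF.
  by have := U0 j jF; rewrite negbK => /eqP->; rewrite scaler0.
have [Fk Fb] := UC _ _ Uj; split; first by move: Fk; rewrite cardsU1 jF eqSS.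
exact: leqdeg_trans Fb (shiftdeg_anti _ (subsetUr _ _)).
Qed.

Lemma kdiff_Bspace k : (kdiff @: Bspace k.+1 <= Bspace k)%VS.
Proof.
apply/subvP=> _ /memv_imgP[U /memBP UB ->]; apply/memBP=> F.
rewrite slice_kdiff; apply: chain_kd UB F => j F _.
exact/PB_anti/subsetUr.
Qed.

Lemma kdiff_Bspace0 : (kdiff @: Bspace 0 = 0)%VS.
Proof.
apply/eqP; rewrite -subv0; apply/subvP=> _ /memv_imgP[U /memBP UB ->].
rewrite memv0; apply/eqP/slice_inj => F; rewrite slice_kdiff linear0.
by apply: big1 => j jF; rewrite (chain_out UB) ?scaler0 // cardsU1 jF andbF.
Qed.

(** The complex splits over [b] into full simplices on the [j] with [dG b j < al j]. A nonempty
    simplex is contracted by the cone from any vertex; the last hypothesis makes [U] vanish on the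
    empty ones. *)
Lemma Cspace_exact k U : U \in Cspace k -> kdiff U = 0 ->
  (forall b, U (set0, b) != 0 -> exists j, dG b j < al j) ->
  U \in (kdiff @: Cspace k.+1)%VS.
Proof.
move=> /memCP UC U0 Ub.
pose z b F : K^o := U (F, b).
pose v b F := if [pick j | dG b j < al j] is Some j then cone j (z b) F else 0.
pose T : KV := [ffun q => v q.2 q.1].
have -> : U = kdiff T.
  apply/ffunP=> -[F b]; rewrite kdiffE.
  have -> : kd (fun F => T (F, b) : K^o) F = kd (v b) F.
    by apply: kd_eq => F'; rewrite ffunE.
  rewrite /v; case: pickP => [j bj|nj].
    have kz F' : kd (z b) F' = 0 by rewrite -kdiffE U0 ffunE.
    by rewrite kd_cone /cone kz scaler0 if_same subr0.
  rewrite kd0; apply/eqP; apply/negP=> /negP nz.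
  have [F0|[j jF]] := set_0Vmem F.
    by rewrite F0 in nz; have [j bj] := Ub _ nz; rewrite nj in bj.
  have [_] := UC _ _ nz; rewrite leqdeg_shift => /andP[_ /subsetP/(_ j jF)].
  by rewrite inE nj.
apply: memv_img; apply/memCP=> F b; rewrite ffunE /= /v.
case: pickP => [j bj|_]; last by rewrite eqxx.
rewrite /cone; case: ifP => [jF|]; last by rewrite eqxx.
rewrite scaler_eq0 signr_eq0 /= => /UC[Fk].
rewrite !leqdeg_shift => /andP[-> /subsetP Fb]; split.
  by rewrite -(setD1K jF) cardsU1 setD11 (eqP Fk).
apply/subsetP=> i iF; have [->|ij] := eqVneq i j; first by rewrite inE.
by apply: Fb; rewrite !inE ij.
Qed.

Hypothesis min_coef : forall a b,
  leqdeg (dG b) (dE a) -> leqdeg (dE a) (dG b) -> c b a = 0.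

(* By minimality Phi(E) has no component along a generator of degree alpha. *)
Lemma Bspace_top k U b : U \in Bspace k -> U (set0, b) != 0 -> exists j, dG b j < al j.
Proof.
move=> UB nz; apply/existsP; apply: contraNT nz => /existsPn nj.
have /memBP/chain_sub/(_ (sub0set _)) := UB; move/(span_ffun0 (t := b)).
rewrite ffunE => -> // _ /mapP[a + ->]; rewrite mem_enum inE ffunE => aal.
rewrite /pcoef; case: ifP => // ba; apply: min_coef => //; apply/forallP=> j.
by move/forallP: aal => /(_ j); rewrite /shiftdeg inE subr0 => /le_trans; apply; rewrite leNgt nj.
Qed.

(** The connecting map for B -> C -> C/B: C is exact in positive degrees and all of B in degree 0
    bounds in C, so the homology of C/B in degree [k.+1] is that of B in degree [k]. *)
Lemma betti_succ k : betti dG dE c al k.+1 =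
  (\dim (Bspace k :&: lker kdiff) - \dim (kdiff @: Bspace k.+1))%N.
Proof.
(* Rank-nullity for [kdiff] on both spaces: the kernels agree and cancel, and the images are the
   cycles and the boundaries of B. *)
rewrite /betti -(limg_ker_dim kdiff (Zspace _ _ _ _ _)).
rewrite -(limg_ker_dim kdiff (Bdspace _ _ _ _ _)).
have eX : (kdiff @: Cspace k.+2 = Cspace k.+1 :&: lker kdiff)%VS.
  apply/eqP; rewrite eqEsubv subv_cap kdiff_Cspace /=; apply/andP; split.
    by apply/subvP=> _ /memv_imgP[U _ ->]; rewrite memv_ker kdiffK.
  apply/subvP=> U /memv_capP[UC]; rewrite memv_ker => /eqP U0.
  apply: Cspace_exact => // b nz; have /memCP/(_ _ _ nz)[] := UC.
  by rewrite cards0.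
have -> : (Zspace dG dE c al k.+1 :&: lker kdiff = Cspace k.+1 :&: lker kdiff)%VS.
  apply/vspaceP=> U; rewrite !memv_cap memv_ker -memv_preim.
  by case: eqP => [->|_]; rewrite ?mem0v ?andbT ?andbF.
have -> : (Bdspace dG dE c al k.+1 :&: lker kdiff = Cspace k.+1 :&: lker kdiff)%VS.
  apply/eqP; rewrite eqEsubv subv_cap capvSr andbT -{2}eX addvSl andbT.
  by rewrite capvS // subv_add eX capvSl Bspace_sub.
rewrite subnDl; congr (_ - _)%N; congr (\dim _).
  apply/vspaceP=> U; rewrite memv_cap memv_ker; apply/memv_imgP/andP.
    by case=> T /memv_capP[_]; rewrite -memv_preim /= => TB ->; rewrite kdiffK.
  case=> UB /eqP U0.
  have /memv_imgP[T TC UT] : U \in (kdiff @: Cspace k.+1)%VS.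
    apply: Cspace_exact => //; first exact: subvP (Bspace_sub k) _ UB.
    by move=> b; apply: Bspace_top UB.
  by exists T => //; rewrite memv_cap TC -memv_preim /= -UT.
rewrite /Bdspace limgD; apply/eqP; rewrite eqEsubv addvSr andbT.
rewrite subv_add subvv andbT; apply/subvP=> _ /memv_imgP[_ /memv_imgP[T _ ->] ->].
by rewrite kdiffK mem0v.
Qed.

Lemma kdiff_Bspace_ker k : (kdiff @: Bspace k.+1 <= Bspace k :&: lker kdiff)%VS.
Proof.
rewrite subv_cap kdiff_Bspace /=.
by apply/subvP=> _ /memv_imgP[U _ ->]; rewrite memv_ker kdiffK.
Qed.

Lemma betti_exact k : exact setT PB k -> betti dG dE c al k.+1 = 0%N.
Proof.
move=> ex; rewrite betti_succ; apply/eqP; rewrite subn_eq0; apply: dimvS.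
apply/subvP=> U /memv_capP[/memBP UB]; rewrite memv_ker => /eqP U0.
have [|v vP vu] := ex _ UB; first by move=> F; rewrite -slice_kdiff U0 linear0.
have -> : U = kdiff (unslice v).
  by apply: slice_inj => F; rewrite slice_kdiff (kd_eq (unsliceK v)) vu.
by apply/memv_img/memBP=> F; rewrite unsliceK; apply: vP.
Qed.

(** The Euler characteristic on homology and on chains; [m < n] makes the range cover every
    degree. *)
Lemma sum_betti n : (m < n)%N ->
  \sum_(k < n) (-1) ^+ k * (betti dG dE c al k.+1)%:Z =
  \sum_(F : {set 'I_m}) (-1) ^+ #|F| * (\dim (PB F))%:Z.
Proof.
move=> mn.
transitivity (\sum_(k < n) (-1) ^+ k * (\dim (Bspace k))%:Z); last first.
  have Fn (F : {set 'I_m}) : (#|F| < n)%N.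
    by rewrite (leq_ltn_trans _ mn) // -[leqRHS]card_ord max_card.
  rewrite [RHS](partition_big (fun F => Ordinal (Fn F)) xpredT) //=; apply: eq_bigr => k _.
  rewrite dim_Bspace -natz natr_sum mulr_sumr; apply: eq_big => // F /eqP <-.
  by rewrite natz.
have rn : \dim (kdiff @: Bspace n) = 0%N.
  rewrite BspaceE big_pred0 ?limg0 ?dimv0 // => F; apply/negP=> /eqP Fn.
  by move: mn; rewrite -Fn ltnNge -[leqRHS]card_ord max_card.
(* For arbitrary [n] the truncated sums differ by the rank of the next differential. It vanishes
   here, but the induction needs it. *)
have {mn rn}-> : \sum_(k < n) (-1) ^+ k * (betti dG dE c al k.+1)%:Z =
   \sum_(k < n) (-1) ^+ k * (betti dG dE c al k.+1)%:Z
     - (-1) ^+ n * (\dim (kdiff @: Bspace n))%:Z by rewrite rn mulr0 subr0.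
elim: n => [|n IH]; first by rewrite !big_ord0 kdiff_Bspace0 dimv0 mulr0 subr0.
rewrite !big_ord_recr /= -IH betti_succ -subzn ?dimvS ?kdiff_Bspace_ker //.
rewrite -(limg_ker_dim kdiff (Bspace n)) PoszD exprS; ring.
Qed.
End KoszulHomology.

(** * Alternating sums over subsets *)

Section AlternatingSums.
Variable T : finType.
Implicit Types (D F : {set T}) (g : {set T} -> int).

Lemma altsum_toggle D x g : x \in D ->
  \sum_(F in powerset D) (-1) ^+ #|F| * g F =
  \sum_(F in powerset (D :\ x)) (-1) ^+ #|F| * (g F - g (x |: F)).
Proof.
move=> xD; rewrite (bigID (fun F => x \in F)) /= addrC.
under [RHS]eq_bigr do rewrite mulrBr.
rewrite big_split /=; congr (_ + _).
  by apply: eq_bigl => F; rewrite !powersetE subsetD1.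
rewrite (reindex_onto (fun F => x |: F) (fun F => F :\ x)) /=; last first.
  by move=> F /andP[_ xF]; rewrite setD1K.
apply: eq_big => [F|F /andP[_ /eqP xF]].
  rewrite !powersetE subUset sub1set xD setU11 andbT /= subsetD1; congr (_ && _).
  apply/eqP/idP => [<-|xF]; first by rewrite !inE eqxx.
  by rewrite setU1K.
have {}xF : x \notin F by rewrite -xF !inE eqxx.
by rewrite cardsU1 xF exprS mulN1r mulNr.
Qed.

(** The numerical counterpart of [exact_cone]: [F] and [x |: F] cancel. *)
Lemma altsum_cone D x g : x \in D ->
  (forall F, F \subset D :\ x -> g (x |: F) = g F) ->
  \sum_(F in powerset D) (-1) ^+ #|F| * g F = 0.
Proof.
move=> xD gx; rewrite (altsum_toggle _ xD) big1 // => F; rewrite powersetE => FD.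
by rewrite gx // subrr mulr0.
Qed.
End AlternatingSums.

(** * Generic degrees *)

Section Generic.
Variables (K : fieldType) (m : nat) (Gb S : finType).
Variables (dG : Gb -> mdeg m) (dE : S -> mdeg m) (c : Gb -> S -> K) (al : mdeg m).
Variables (Il Iu : {set S}).
Implicit Types (D F : {set 'I_m}) (A J : {set S}).

Local Notation V := {ffun Gb -> K^o}.
Local Notation Vsp := (Vsp dG dE c).
Local Notation below := (below dE al).
Local Notation PB := (fun F => Vsp (below F)).
Local Notation Ic := (Iu :\: Il).

Lemma VspE A : Vsp A = (\sum_(a in A) <[colvec dG dE c a]>)%VS.
Proof. by rewrite /Defs.Vsp span_def big_map big_enum. Qed.

Lemma VspU A A' : Vsp (A :|: A') = (Vsp A + Vsp A')%VS.
Proof.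
apply/eqP; rewrite eqEsubv subv_add !Vsp_mono ?subsetUl ?subsetUr // !andbT.
rewrite (VspE (_ :|: _)); apply/subv_sumP=> a; rewrite inE => /orP[] aA.
  by rewrite (subv_trans _ (addvSl _ _)) // VspE (sumv_sup a).
by rewrite (subv_trans _ (addvSr _ _)) // VspE (sumv_sup a).
Qed.

Lemma belowE F : below F = [set a | leqdeg (dE a) al && (F \subset [set j | dE a j < al j])].
Proof. by apply/setP=> a; rewrite !inE leqdeg_shift. Qed.

Lemma belowU F F' : below (F :|: F') = below F :&: below F'.
Proof. by rewrite !belowE; apply/setP=> a; rewrite !inE subUset; case: leqdeg. Qed.

Lemma mem_below F a : a \in below set0 -> (a \in below F) = [forall j in F, a \in below [set j]].
Proof.
rewrite !belowE !inE sub0set andbT => aal; rewrite aal /=.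
apply/subsetP/forall_inP => aF j /aF; rewrite !belowE ?inE sub1set ?inE ?aal //.
Qed.

(** Exactness off one degree leaves a single Betti number, so the Euler characteristic gives its
    value up to sign. *)
Lemma betti_of_exact :
  (forall a b, leqdeg (dG b) (dE a) -> leqdeg (dE a) (dG b) -> c b a = 0) ->
  Il != set0 ->
  (forall k, (k + mrank dG dE c Ic Il != #|Il|)%N -> exact setT PB k) ->
  \sum_(F : {set 'I_m}) (-1) ^+ #|F| * (\dim (PB F))%:Z =
  \sum_(J in powerset Il) (-1) ^+ #|Il :\: J| * (\dim (Vsp (Ic :|: J)))%:Z ->
  forall i : nat, (1 <= i)%N ->
    (betti dG dE c al i)%:Z =
      (if i == (#|Il| - mrank dG dE c Ic Il + 1)%N
       then beta_inv dG dE c Il Ic else 0).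
Proof.
move=> minc /set0Pn[x xIl] ex euler [//|k] _.
set r := mrank _ _ _ _ _ in ex *.
(* This makes the truncated subtraction [#|Il| - r] a true one. *)
have rIl : (r <= #|Il|)%N.
  rewrite leq_subLR VspU (leq_trans (dimv_add_leqif _ _).1) // leq_add2l.
  by rewrite (leq_trans (dim_span _)) // size_map -cardE.
have b0 j : (j != #|Il| - r)%N -> betti dG dE c al j.+1 = 0%N.
  by move=> jr; apply/(betti_exact minc)/ex; move: jr rIl; lia.
rewrite addn1 eqSS; case: eqP => [->|/eqP/b0->] //; set k0 := (#|Il| - r)%N.
have bd : (-1) ^+ k0 * (betti dG dE c al k0.+1)%:Z =
    \sum_(F : {set 'I_m}) (-1) ^+ #|F| * (\dim (PB F))%:Z.
  have k0n : (k0 < (m + k0).+1)%N by lia.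
  rewrite -(sum_betti (n := (m + k0).+1) al minc) ?ltnS ?leq_addr //.
  rewrite (bigD1 (Ordinal k0n)) //= big1 ?addr0 // => j; rewrite -val_eqE /= => /b0->.
  by rewrite mulr0.
rewrite -[LHS]mul1r -(sqrr_sign _ k0) expr2 -mulrA bd euler /beta_inv -/r.
(* Rank and dimension differ by the constant [\dim (Vsp Ic)], whose alternating sum over subsets of
   the nonempty [Il] is zero. *)
have -> : \sum_(J in powerset Il) (-1) ^+ #|J| * (mrank dG dE c Ic J)%:Z =
  \sum_(J in powerset Il) (-1) ^+ #|J| * (\dim (Vsp (Ic :|: J)))%:Z.
  have := @altsum_cone _ Il x (fun=> (\dim (Vsp Ic))%:Z) xIl (fun _ _ => erefl).
  move=> a0; rewrite -[RHS]subr0 -[X in _ - X]a0 -sumrB; apply: eq_bigr => J _.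
  by rewrite -mulrBr subzn // dimvS // Vsp_mono ?subsetUl.
rewrite !mulr_sumr; apply: eq_bigr => J; rewrite powersetE => JIl.
rewrite !mulrA; congr (_ * _); rewrite -!exprD.
(* [k0 + #|Il :\: J|] and [r + #|J|] have the same parity, since [#|Il|] occurs twice. *)
rewrite -[LHS]signr_odd -[RHS]signr_odd; congr (_ ^+ nat_of_bool _).
rewrite cardsDS // oddD oddD.
have := subset_leq_card JIl; rewrite /k0 => JI.
by clearbody r; rewrite !oddB //; case: (odd r); case: (odd #|Il|); case: (odd #|J|).
Qed.

Hypothesis lattice : in_lcm_lattice dE al.
Hypothesis generic : forall A, has_deg dE A al = (Il \subset A) && (A \subset Iu).

Lemma Il_sub : Il \subset Iu.
Proof. by case: lattice => A; rewrite generic => /andP[/subset_trans]; apply. Qed.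

(** Adding to [Iu] a generator of degree at most [al] keeps the degree [al], so genericity already
    puts it in [Iu]. *)
Lemma below0 : below set0 = Iu.
Proof.
have : has_deg dE Iu al by rewrite generic Il_sub subxx.
case/and3P=> _ /forall_inP IuP /forallP Iuj.
apply/setP=> a; rewrite belowE inE sub0set andbT; apply/idP/idP; last exact: IuP.
move=> aal; have : has_deg dE (a |: Iu) al.
  apply/and3P; split; first by apply/set0Pn; exists a; rewrite setU11.
    by apply/forall_inP=> b; rewrite !inE => /orP[/eqP->|/IuP].
  apply/forallP=> j; have /exists_inP[b bI bj] := Iuj j.
  by apply/exists_inP; exists b => //; rewrite inE bI orbT.
by rewrite generic subUset sub1set => /andP[_ /andP[]].
Qed.

Lemma Il_neq0 : Il != set0.
Proof.
apply/eqP=> I0; have := generic set0.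
by rewrite I0 !sub0set /has_deg eqxx.
Qed.

(** [Il] itself has degree [al], so some element of it attains [al j]. *)
Lemma below1_nsub j : ~~ (Il \subset below [set j]).
Proof.
have : has_deg dE Il al by rewrite generic Il_sub subxx.
case/and3P=> _ _ /forallP/(_ j)/exists_inP[a aI /eqP aj].
apply: contraTN isT => /subsetP/(_ a aI); rewrite belowE inE sub1set inE aj.
by rewrite ltxx andbF.
Qed.

Lemma below_sub F : below F \subset Iu.
Proof. by rewrite -below0 -[F]setU0 belowU subsetIr. Qed.

(** [Iu :\ x] does not have degree [al], so in some coordinate [j] none of its elements attains
    [al j]; [below1_nsub] then keeps [x] out. *)
Lemma ex_facet x : (0 < m)%N -> x \in Il -> exists j, below [set j] = Iu :\ x.
Proof.
move=> m0 xI.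
have hN : ~~ has_deg dE (Iu :\ x) al.
  rewrite generic negb_and; apply/orP; left.
  by apply/subsetPn; exists x; rewrite // !inE eqxx.
have le a : a \in Iu -> leqdeg (dE a) al by rewrite -below0 belowE inE => /andP[].
have [j jP] : exists j, forall a, a \in Iu :\ x -> dE a j != al j.
  (* If [x] is alone in [Iu], any variable will do, and [0 < m] supplies one. *)
  have [I0|In0] := eqVneq (Iu :\ x) set0.
    by exists (Ordinal m0) => a; rewrite I0 inE.
  move: hN; rewrite /has_deg In0 /=; case/nandP.
    by case/forall_inPn=> a; rewrite inE => /andP[_ /le->].
  by case/forallPn=> j /exists_inPn jP; exists j.
have sI : Iu :\ x \subset below [set j].
  apply/subsetP=> a aI; rewrite belowE inE sub1set inE lt_neqAle jP //=.
  have /le aal : a \in Iu by move: aI; rewrite inE => /andP[].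
  by rewrite aal; apply: (forallP aal).
exists j; apply/eqP; rewrite eqEsubset sI andbT subsetD1 below_sub.
apply: contra (below1_nsub j) => xj.
by rewrite (subset_trans Il_sub) // -(setD1K (subsetP Il_sub _ xI)) subUset sub1set xj.
Qed.

(** * Facet variables and dominated variables *)

Section Facets.
Variable f : S -> 'I_m.
Hypothesis fP : forall x, x \in Il -> below [set f x] = Iu :\ x.
Let D0 := f @: Il.

Lemma facet_inj : {in Il &, injective f}.
Proof.
move=> x y xI yI fxy; apply/eqP; apply: contraTT (subsetP Il_sub x xI) => xy.
have : x \notin Iu :\ x by rewrite !inE eqxx.
by rewrite -(fP xI) fxy (fP yI) !inE xy.
Qed.

Lemma below_facets F : F \subset D0 -> below F = Ic :|: [set x in Il | f x \notin F].
Proof.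
move=> FD; apply/setP=> a; rewrite in_setU in_setD [X in _ || X]inE -below0.
have [a0|a0] := boolP (a \in below set0); last first.
  rewrite andbF /=; have /negbTE-> : a \notin below F.
    by apply: contra a0; rewrite below0; apply/subsetP/below_sub.
  by apply/esym/negbTE; rewrite negb_and (contra _ a0) // below0; apply/subsetP/Il_sub.
rewrite mem_below // andbT; have [aI|aI] /= := boolP (a \in Il).
  apply/forall_inP/idP => [aF|afF j jF].
    by apply/negP=> /aF; rewrite fP // !inE eqxx.
  have /imsetP[x xI jx] := subsetP FD j jF; rewrite jx fP // !inE -below0 a0 andbT.
  by apply: contraNneq afF => ->; rewrite -jx.
apply/forall_inP=> j jF; have /imsetP[x xI ->] := subsetP FD j jF.
by rewrite fP // !inE -below0 a0 andbT; apply: contraNneq aI => ->.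
Qed.

(** The vectors of [Il] reindexed by variables: since [f] is injective on [Il], the sum has one term
    for [t] in [D0] and none otherwise. *)
Let w t : V := \sum_(x in Il | f x == t) colvec dG dE c x.

Lemma Vsp_facets F : F \subset D0 -> Vsp (below F) = cospan w D0 (Vsp Ic) F.
Proof.
move=> FD; rewrite below_facets // VspU /cospan; congr (_ + _)%VS.
have -> : D0 :\: F = f @: [set x in Il | f x \notin F].
  apply/setP=> t; rewrite inE; apply/andP/imsetP.
    by case=> tF /imsetP[x xI tx]; exists x => //; rewrite inE xI -tx.
  by case=> x; rewrite inE => /andP[xI xF] ->; rewrite xF imset_f.
rewrite big_imset /=; last first.
  by move=> x y; rewrite !inE => /andP[xI _] /andP[yI _]; apply: facet_inj.
rewrite VspE; apply: eq_bigr => x; rewrite inE => /andP[xI _]; congr <[_]>%VS.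
rewrite /w (big_pred1 x) // => y; apply/andP/eqP => [[yI /eqP]|->]; last by rewrite xI eqxx.
exact: facet_inj.
Qed.

Lemma exact_facets k : (k + mrank dG dE c Ic Il != #|Il|)%N -> exact D0 PB k.
Proof.
move=> kr; apply: (@eq_exact _ _ _ _ (cospan w D0 (Vsp Ic))).
  by move=> F FD; rewrite Vsp_facets.
apply: exact_cospan; rewrite -Vsp_facets ?sub0set // below0 card_in_imset; last exact: facet_inj.
(* [Ic :|: Il] is [Iu], which turns the rank condition into the dimension condition of
   [exact_cospan]. *)
move: kr; rewrite /mrank setUC -{1}(setIidPr Il_sub) setID.
have : (\dim (Vsp Ic) <= \dim (Vsp Iu))%N by rewrite dimvS // Vsp_mono // subsetDl.
by move: #|Il| (\dim (Vsp Iu)) (\dim (Vsp Ic)) => a b d; lia.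
Qed.

(** Some [x] in [Il] is missing from [below [set j]], which therefore lies in [Iu :\ x], that is
    [below [set f x]]; next to [j], adding [f x] imposes nothing new. *)
Lemma below_dominated j : exists2 y, y \in D0 & forall F, below (j |: (y |: F)) = below (j |: F).
Proof.
have /subsetPn[x xI xj] := below1_nsub j.
exists (f x); first exact: imset_f.
move=> F; rewrite setUA !belowU fP //; congr (_ :&: _).
by apply/setIidPl; rewrite subsetD1 below_sub.
Qed.

(** Variables outside [D0] are removed one at a time: the part over sets containing [j] has the
    dominating [y] as apex, hence is exact. *)
Lemma exact_expand k D : D0 \subset D -> exact D0 PB k -> exact D PB k.
Proof.
move=> sD ex; have [n] := ubnP #|D :\: D0|; elim: n => // n IHn in D sD *.
rewrite ltnS => Dn; have [DD0|[j]] := set_0Vmem (D :\: D0).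
  by have <- : D0 = D by apply/eqP; rewrite eqEsubset sD -setD_eq0 DD0 eqxx.
rewrite inE => /andP[jD0 jD].
have sD' : D0 \subset D :\ j by rewrite subsetD1 sD.
apply: (exact_link jD) => [F _||k' _].
- exact/PB_anti/subsetUr.
- apply: IHn sD' _; rewrite (leq_trans _ Dn) //.
  rewrite [X in (_ <= X)%N](cardsD1 j) inE jD jD0 add1n ltnS.
  by rewrite !setDDl setUC.
- have [y yD0 yj] := below_dominated j.
  by apply: (exact_cone (subsetP sD' y yD0)) => F _; rewrite yj.
Qed.

(** The same removal for Euler characteristics. *)
Lemma altsum_expand D : D0 \subset D ->
  \sum_(F in powerset D) (-1) ^+ #|F| * (\dim (PB F))%:Z =
  \sum_(F in powerset D0) (-1) ^+ #|F| * (\dim (PB F))%:Z.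
Proof.
move=> sD; have [n] := ubnP #|D :\: D0|; elim: n => // n IHn in D sD *.
rewrite ltnS => Dn; have [DD0|[j]] := set_0Vmem (D :\: D0).
  by have <- : D0 = D by apply/eqP; rewrite eqEsubset sD -setD_eq0 DD0 eqxx.
rewrite inE => /andP[jD0 jD].
have sD' : D0 \subset D :\ j by rewrite subsetD1 sD.
rewrite (altsum_toggle _ jD); under eq_bigr do rewrite mulrBr.
rewrite sumrB; have [y yD0 yj] := below_dominated j.
rewrite [X in _ - X](altsum_cone (subsetP sD' y yD0)) ?subr0; last first.
  by move=> F _; rewrite yj.
apply: IHn sD' _; rewrite (leq_trans _ Dn) //.
rewrite [X in (_ <= X)%N](cardsD1 j) inE jD jD0 add1n ltnS.
by rewrite !setDDl setUC.
Qed.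

Lemma altsum_facets :
  \sum_(F : {set 'I_m}) (-1) ^+ #|F| * (\dim (PB F))%:Z =
  \sum_(J in powerset Il) (-1) ^+ #|Il :\: J| * (\dim (Vsp (Ic :|: J)))%:Z.
Proof.
transitivity (\sum_(F in powerset D0) (-1) ^+ #|F| * (\dim (PB F))%:Z).
  rewrite -(altsum_expand (subsetT _)).
  by apply: eq_bigl => F; rewrite powersetE subsetT.
(* [F] corresponds to the set [J] of elements of [Il] whose variable is not in [F], so [#|F|] is
   [#|Il :\: J|]. *)
rewrite (reindex_onto (fun J => f @: (Il :\: J)) (fun F => [set x in Il | f x \notin F])) /=.
  apply: eq_big => [J|J /andP[_ /eqP JE]].
    rewrite !powersetE imsetS ?subsetDl //=; apply/eqP/idP => [<-|JI].
      by apply/subsetP=> x; rewrite inE => /andP[].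
    apply/setP=> x; rewrite inE; have [xI|xI] /= := boolP (x \in Il); last first.
      by apply/esym/negbTE; apply: contra xI; apply/subsetP.
    apply/idP/idP => [|xJ]; first by apply: contraR => xJ; rewrite imset_f // inE xJ.
    by apply/imsetP=> -[y /setDP[yI yJ]] /(facet_inj xI yI) xy; rewrite -xy xJ in yJ.
  rewrite card_in_imset; last first.
    by move=> x y /setDP[xI _] /setDP[yI _]; apply: facet_inj.
  by rewrite below_facets ?JE // imsetS // subsetDl.
move=> F; rewrite powersetE => FD; apply/setP=> t; apply/imsetP/idP.
  by case=> x; rewrite !inE => /andP[/nandP[/negbTE->//|/negPn xF] xI] ->.
move=> tF; have /imsetP[x xI tx] := subsetP FD t tF; exists x => //.
by rewrite !inE xI -tx tF.
Qed.
End Facets.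
End Generic.

(** * Assembly, with the ring without variables treated apart *)

Theorem theorem5p6 (K : fieldType) (m : nat) (Gb S : finType)
    (dG : Gb -> mdeg m) (dE : S -> mdeg m) (c : Gb -> S -> K)
    (al : mdeg m) (Il Iu : {set S}) :
  minimal_presentation dG dE c ->
  in_lcm_lattice dE al ->
  (forall A : {set S}, has_deg dE A al = (Il \subset A) && (A \subset Iu)) ->
  forall i : nat, (1 <= i)%N ->
    (betti dG dE c al i)%:Z =
      (if i == (#|Il| - mrank dG dE c (Iu :\: Il) Il + 1)%N
       then beta_inv dG dE c Il (Iu :\: Il) else 0).
Proof.
move=> [min1 min2] lattice generic.
have Iln0 := Il_neq0 generic.
have [m0|m0] := posnP m; last first.
  have [f fP] : exists f : S -> 'I_m, forall x, x \in Il -> below dE al [set f x] = Iu :\ x.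
    apply: (fin_all_exists (P := fun x j => x \in Il -> below dE al [set j] = Iu :\ x)) => x.
    have [xI|xI] := boolP (x \in Il); last by exists (Ordinal m0).
    by have [j jP] := ex_facet lattice generic m0 xI; exists j.
  apply: betti_of_exact => // [k kr|].
    by apply: (exact_expand lattice generic fP (subsetT _)); apply: exact_facets.
  exact: (altsum_facets dG c lattice generic fP).
(* Without variables S = [set x], and only the degree zero term V_S remains. *)
have noj (j : 'I_m) : False by case: j => j; rewrite m0.
have set0_all (F : {set 'I_m}) : F = set0 by apply/setP=> j; case: (noj j).
have hdA (A : {set S}) : has_deg dE A al = (A != set0).
  rewrite /has_deg; case: eqP => //= _; apply/andP; split; last by apply/forallP=> j; case: (noj j).
  by apply/forall_inP=> a _; apply/forallP=> j; case: (noj j).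
have [x xI] := set0Pn _ Iln0.
(* Every singleton has degree [al] here, so it contains [Il] and with it [x]. *)
have Sx a : a = x.
  have : has_deg dE [set a] al by rewrite hdA; apply/set0Pn; exists a; rewrite inE.
  by rewrite generic => /andP[/subsetP/(_ x xI)]; rewrite inE => /eqP->.
have IlE : Il = [set x] by apply/setP=> a; rewrite (Sx a) xI inE eqxx.
have IuE : Iu = [set x].
  by apply/setP=> a; rewrite (Sx a) (subsetP (Il_sub lattice generic) _ xI) inE eqxx.
have Ic0 : Iu :\: Il = set0 by rewrite IlE IuE setDv.
have V0 : \dim (Vsp dG dE c set0) = 0%N by rewrite VspE big_set0 dimv0.
(* By minimality the column of [x] is nonzero, as 0 lies in every span. *)
have V1 : \dim (Vsp dG dE c [set x]) = 1%N.
  rewrite VspE big_set1 dim_vline; case: eqP => // cx0.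
  by have := min2 x; rewrite cx0 mem0v.
apply: betti_of_exact => // [k|].
  rewrite /mrank Ic0 set0U IlE V1 V0 cards1 subn0 addn1 eqSS => k0 u uP _.
  exists (fun=> 0); first by apply: chainI => // F _ _; apply: mem0v.
  by move=> F; rewrite kd0 (chain_out uP) // (set0_all F) cards0 eq_sym (negbTE k0) andbF.
rewrite (big_pred1 set0) => [|F]; last by rewrite [F]set0_all /= eqxx.
rewrite (below0 lattice generic) Ic0 IuE IlE.
rewrite (bigD1 set0) ?powersetE ?sub0set //= (big_pred1 [set x]) => [|J]; last first.
  rewrite powersetE subset1 /=; have [->|_] //= := eqVneq J [set x]; last by rewrite andbN.
  by rewrite -cards_eq0 cards1.
by rewrite !set0U V0 V1 setDv !cards0 mulr0 add0r.
Qed.
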